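(* Let $p,t$ be integers with $1<t<p$, and let $\Gamma^{\{t\}}$ be the graph whose vertices are the $t$-element subsets of $\{1,\dots,p\}$, two distinct vertices being adjacent if and only if they have non-empty intersection. If $p\ge 2t$, then $$S_1(\Gamma^{\{t\}})=\binom{p}{t}\left(\binom{p}{t}-\binom{p-t}{t}-1\right)\left(\binom{p}{t}+\binom{p-t}{t}-1\right),$$ $$S_2(\Gamma^{\{t\}})=\frac12\binom{p}{t}\left(\binom{p}{t}-\binom{p-t}{t}-1\right)\left(\binom{p}{t}+\binom{p-t}{t}-1\right)^2,$$ $$\overline{S_1}(\Gamma^{\{t\}})=\binom{p-t}{t}\binom{p}{t}\left(\binom{p}{t}+\binom{p-t}{t}-1\right),$$ $$\overline{S_2}(\Gamma^{\{t\}})=\left(\binom{\binom{p}{t}}{2}-\frac12\binom{p}{t}\left(\binom{p}{t}-\binom{p-t}{t}-1\right)\right)\left(\binom{p}{t}+\binom{p-t}{t}-1\right)^2.$$ If $p<2t$, then $$S_1(\Gamma^{\{t\}})=\binom{p}{t}\left(\binom{p}{t}-1\right)^2,\qquad S_2(\Gamma^{\{t\}})=\frac12\binom{p}{t}\left(\binom{p}{t}-1\right)^3,$$ $$\overline{S_1}(\Gamma^{\{t\}})=2\binom{\binom{p}{t}}{2}\left(\binom{p}{t}-1\right)-\binom{p}{t}\left(\binom{p}{t}-1\right)^2,$$ $$\overline{S_2}(\Gamma^{\{t\}})=\left(\binom{\binom{p}{t}}{2}-\frac12\binom{p}{t}\left(\binom{p}{t}-1\right)\right)\left(\binom{p}{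t}-1\right)^2.$$
   Context: For a finite connected simple graph $G$, $d_G(u,v)$ is the shortest-path distance and $\sigma_G(u)=\sum_{v\in V(G)}d_G(u,v)$ is the status of $u$. The status connectivity indices are $S_1(G)=\sum_{uv\in E(G)}[\sigma_G(u)+\sigma_G(v)]$ and $S_2(G)=\sum_{uv\in E(G)}\sigma_G(u)\sigma_G(v)$. The status co-indices are $\overline{S_1}(G)=\sum_{uv\notin E(G)}[\sigma_G(u)+\sigma_G(v)]$ and $\overline{S_2}(G)=\sum_{uv\notin E(G)}\sigma_G(u)\sigma_G(v)$, where the sums over $uv\notin E(G)$ range over unordered pairs of distinct non-adjacent vertices. *)

(* Defs.v *)
From mathcomp Require Import all_boot all_order all_algebra.

Set Implicit Arguments.
Unset Strict Implicit.
Unset Printing Implicit Defensive.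

Record sgraph := SGraph {
  vertex :> finType;
  adj : rel vertex;
  adj_sym : symmetric adj;
  adj_irr : irreflexive adj }.

Section StatusIndices.
Variable G : sgraph.
Implicit Types (u v w : G) (e : {set G}).

Definition connected := forall u v, connect (@adj G) u v.

Definition walk u v (n : nat) : bool :=
  [exists q : n.-tuple G, path (@adj G) u q && (last u q == v)].

Lemma connect_walk u v : connect (@adj G) u v -> exists n, walk u v n.
Proof.
case/connectP=> q pq ->; exists (size q); apply/existsP.
by exists (in_tuple q); rewrite /= pq eqxx.
Qed.

(* The value 0 for vertices in different components is a dummy: all the notions
   below are meant for connected graphs only. *)
Definition dist u v : nat :=
  if @idP (connect (@adj G) u v) is ReflectT uv then ex_minn (connect_walk uv)
  else 0.

Definition status u : nat := \sum_v dist u v.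

(* Unordered pairs uv of distinct vertices are represented by two-element sets
   [set u; v], so that sums (products) over the elements of the pair are
   status u + status v (status u * status v). *)
Definition edges : {set {set G}} :=
  [set [set uv.1; uv.2] | uv : G * G & adj uv.1 uv.2].

Definition nonedges : {set {set G}} :=
  [set [set uv.1; uv.2] | uv : G * G & (uv.1 != uv.2) && ~~ adj uv.1 uv.2].

Definition S1 : nat := \sum_(e in edges) \sum_(w in e) status w.
Definition S2 : nat := \sum_(e in edges) \prod_(w in e) status w.
Definition coS1 : nat := \sum_(e in nonedges) \sum_(w in e) status w.
Definition coS2 : nat := \sum_(e in nonedges) \prod_(w in e) status w.

End StatusIndices.

Section IntersectionGraph.
Variables p t : nat.

(* The ground set {1, ..., p} is represented by 'I_p = {0, ..., p - 1}. *)
Definition tsubset := {A : {set 'I_p} | #|A| == t}.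

Definition meets : rel tsubset :=
  fun A B => (A != B) && (val A :&: val B != set0).

Lemma meets_sym : symmetric meets.
Proof. by move=> A B; rewrite /meets eq_sym setIC. Qed.

Lemma meets_irr : irreflexive meets.
Proof. by move=> A; rewrite /meets eqxx. Qed.

Definition Gamma : sgraph := SGraph meets_sym meets_irr.

Lemma Gamma_connected : 1 < t -> connected Gamma.
Proof.
move=> t_gt1 A B.
have nz (X : tsubset) : exists x, x \in val X.
  by apply/card_gt0P; rewrite (eqP (valP X)) ltnW.
have meet (X Y : tsubset) x :
    x \in val X -> x \in val Y -> connect (@adj Gamma) X Y.
  move=> xX xY; have [->|neq] := eqVneq X Y; first exact: connect0.
  by apply: connect1; rewrite /= /meets neq; apply/set0Pn; exists x; apply/setIP.
have [[a aA] [b bB]] := (nz A, nz B).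
have t_le : t <= p.
  by rewrite -(eqP (valP A)) -[X in _ <= X]card_ord max_card.
(* a t-subset containing both a and b *)
have [C [abC cC]] : exists C : {set 'I_p}, [set a; b] \subset C /\ #|C| == t.
  pose s := enum [set a; b] ++ enum (~: [set a; b]).
  have us : uniq s.
    rewrite cat_uniq !enum_uniq andbT /=; apply/hasPn=> x.
    by rewrite !mem_enum inE.
  have ss : size s = p by rewrite size_cat -!cardE cardsC card_ord.
  have s2 : size (enum [set a; b]) <= t.
    by rewrite -cardE cards2; apply: leq_trans t_gt1; case: (_ != _).
  exists [set x in take t s]; split.
    apply/subsetP=> x xab; rewrite inE take_cat ltnNge s2 /= mem_cat.
    by rewrite mem_enum xab.
  by rewrite cardsE (card_uniqP (take_uniq _ us)) size_takel // ss.
pose D : tsubset := exist _ C cC.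
apply: (@connect_trans _ _ D).
  by apply: (meet A D a) => //; apply: (subsetP abC); rewrite !inE eqxx.
by apply: (meet D B b) => //; apply: (subsetP abC); rewrite !inE eqxx orbT.
Qed.

End IntersectionGraph.

(* Main.v *)
(* Two disjoint t-subsets A, B with t > 1 have a common neighbour, obtained by
   exchanging one point of A for a point of B, so the graph has diameter at most
   two.  Each vertex has K = C(p - t, t) non-neighbours, all at distance 2, and
   N - K - 1 neighbours, so every status equals N + K - 1 and the indices follow
   from counting edges and non-edges.  When p < 2t, K = 0. *)
Require Import Defs.
From mathcomp Require Import all_boot all_order all_algebra.
From mathcomp Require Import ring zify.
Set Implicit Arguments.
Unset Strict Implicit.
Unset Printing Implicit Defensive.
Import Order.TTheory GRing.Theory Num.Theory.
Local Open Scope ring_scope.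

(** * Counting the unordered pairs of a symmetric irreflexive relation *)

Section RelationPairs.
Variables (T : finType) (r : rel T).
Hypotheses (r_sym : symmetric r) (r_irr : irreflexive r).

(** Both [edges] and [nonedges] are convertible to instances of this set, for [adj] and for [coadj]
    below, so they are counted by the same lemmas. *)
Definition rel_pairs : {set {set T}} :=
  [set [set uv.1; uv.2] | uv : T * T & r uv.1 uv.2].

Lemma card_in_rel_pairs e : e \in rel_pairs -> #|e| = 2.
Proof.
case/imsetP=> -[u v]; rewrite inE /= => ruv ->.
by rewrite cards2; case: eqVneq ruv => // ->; rewrite r_irr.
Qed.

(** Handshake argument: the right-hand side counts ordered pairs, and each unordered pair arises
    from exactly two of them. *)
Lemma double_card_rel_pairs : (#|rel_pairs|.*2 = \sum_u #|r u|)%N.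
Proof.
have -> : (\sum_u #|r u| = \sum_(uv in [set uv : T * T | r uv.1 uv.2]) 1)%N.
  rewrite (eq_bigl (fun uv : T * T => true && r uv.1 uv.2)); last first.
    by move=> uv; rewrite inE.
  rewrite -(pair_big_dep predT r (fun _ _ => 1%N)) /=.
  by apply: eq_bigr => u _; rewrite sum1_card.
(* Group the ordered pairs by their underlying set; the fibre over [[set u; v]] is then shown to be
   [[set (u, v); (v, u)]]. *)
rewrite (partition_big_imset (fun uv : T * T => [set uv.1; uv.2])) /=.
rewrite -muln2 -sum_nat_const.
apply: eq_bigr => e /imsetP[[u v]]; rewrite inE /= => ruv ->.
have neq_uv : u != v by apply: contraTneq ruv => ->; rewrite r_irr.
rewrite sum1dep_card -[2%N](_ : #|[set (u, v); (v, u)]| = 2%N); last first.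
  by rewrite cards2 xpair_eqE negb_and neq_uv.
apply: eq_card => -[x y]; rewrite !inE /= !xpair_eqE.
apply/orP/andP => [|[rxy /eqP Exy]].
  by case=> /andP[/eqP-> /eqP->]; split; rewrite // 1?r_sym // setUC.
have xuv : x \in [set u; v] by rewrite -Exy set21.
have yuv : y \in [set u; v] by rewrite -Exy set22.
have neq_xy : x != y by apply: contraTneq rxy => ->; rewrite r_irr.
move: xuv yuv neq_xy; rewrite !inE.
by case/orP=> /eqP-> /orP[]/eqP->; rewrite ?eqxx //; [left|right].
Qed.

End RelationPairs.

(** * Distances and statuses in diameter at most two *)

Section Distance.
Variable G : sgraph.
Implicit Types u v w : G.

Definition coadj u v := (u != v) && ~~ adj u v.

Lemma coadj_sym : symmetric coadj.
Proof. by move=> u v; rewrite /coadj eq_sym adj_sym. Qed.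

Lemma coadj_irr : irreflexive coadj.
Proof. by move=> u; rewrite /coadj eqxx. Qed.

Lemma dist_eq u v n :
  walk u v n -> (forall m, walk u v m -> (n <= m)%N) -> dist u v = n.
Proof.
(* The dummy value of [dist] cannot occur, since the walk of length [n] connects [u] to [v]. *)
move=> wn min_n; rewrite /dist; case: {-}_ / idP => [uv|]; last first.
  case; case/existsP: wn => q /andP[pq /eqP <-].
  by apply/connectP; exists q.
case: ex_minnP => m wm min_m; apply/eqP.
by rewrite eqn_leq min_m // min_n.
Qed.

Lemma walk0 u v : walk u v 0 = (u == v).
Proof.
apply/existsP/idP => [[q]|/eqP->]; first by rewrite tuple0.
by exists [tuple]; rewrite /= eqxx.
Qed.

Lemma walk1 u v : walk u v 1 = adj u v.
Proof.
apply/existsP/idP => [[q]|auv]; last by exists [tuple v]; rewrite /= auv eqxx.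
by case/tupleP: q => w q; rewrite tuple0 /= andbT => /andP[auw /eqP<-].
Qed.

Lemma dist_self u : dist u u = 0%N.
Proof. by apply: dist_eq; rewrite ?walk0. Qed.

Lemma dist_adj u v : adj u v -> dist u v = 1%N.
Proof.
move=> auv; apply: dist_eq; rewrite ?walk1 // => -[] //.
by rewrite walk0 => /eqP euv; rewrite euv adj_irr in auv.
Qed.

Lemma dist_common_neighbour u v w :
  coadj u v -> adj u w -> adj w v -> dist u v = 2%N.
Proof.
case/andP=> neq nadj auw awv; apply: dist_eq.
  by apply/existsP; exists [tuple w; v]; rewrite /= auw awv eqxx.
by move=> [|[|m]] //; rewrite ?walk0 ?walk1 ?(negPf neq) ?(negPf nadj).
Qed.

Lemma card_adj_coadj u : (#|@adj G u| + #|coadj u|).+1 = #|G|.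
Proof.
rewrite -[in RHS](cardC (pred1 u)) card1 add1n -[in RHS](cardID (@adj G u)).
congr _.+1; congr (_ + _)%N; apply: eq_card => v; rewrite !inE.
  by rewrite [LHS]/in_mem /=; case: eqVneq => [->|]; rewrite ?adj_irr ?andbT.
by rewrite [LHS]/in_mem /= /coadj eq_sym andbC.
Qed.

Lemma status_diameter2 u :
    (forall v, coadj u v -> exists2 w, adj u w & adj w v) ->
  status u = (#|@adj G u| + #|coadj u|.*2)%N.
Proof.
move=> diam2; rewrite /status -muln2 -sum1_card -sum_nat_const.
(* With indicators, all sums range over every vertex and are compared termwise: the distance is 1 on
   neighbours, 2 on non-neighbours and 0 at [u]. *)
rewrite (big_mkcond (mem (@adj G u))) (big_mkcond (mem (coadj u))) /=.
rewrite -big_split /=.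
apply: eq_bigr => v _; rewrite /in_mem /=.
have [auv|nauv] := boolP (adj u v).
  by rewrite dist_adj // /coadj auv andbF.
have [cuv|] := boolP (coadj u v).
  by have [w auw awv] := diam2 v cuv; rewrite (dist_common_neighbour cuv auw).
by rewrite /coadj nauv andbT negbK => /eqP->; rewrite dist_self.
Qed.

End Distance.

(** * Indices of a graph with constant status *)

Section ConstantStatus.
Variables (G : sgraph) (s : nat).
Hypothesis statusE : forall u : G, status u = s.

Lemma S1_const_status : S1 G = (#|edges G| * (2 * s))%N.
Proof.
rewrite -sum_nat_const; apply: eq_bigr => e eE.
rewrite (eq_bigr (fun=> s)) // sum_nat_const.
by rewrite (card_in_rel_pairs (@adj_irr G)).
Qed.

Lemma S2_const_status : S2 G = (#|edges G| * s ^ 2)%N.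
Proof.
rewrite -sum_nat_const; apply: eq_bigr => e eE.
rewrite (eq_bigr (fun=> s)) // prod_nat_const.
by rewrite (card_in_rel_pairs (@adj_irr G)).
Qed.

Lemma coS1_const_status : coS1 G = (#|nonedges G| * (2 * s))%N.
Proof.
rewrite -sum_nat_const; apply: eq_bigr => e eE.
rewrite (eq_bigr (fun=> s)) // sum_nat_const.
by rewrite (card_in_rel_pairs (@coadj_irr G)).
Qed.

Lemma coS2_const_status : coS2 G = (#|nonedges G| * s ^ 2)%N.
Proof.
rewrite -sum_nat_const; apply: eq_bigr => e eE.
rewrite (eq_bigr (fun=> s)) // prod_nat_const.
by rewrite (card_in_rel_pairs (@coadj_irr G)).
Qed.

End ConstantStatus.

(** * Degrees and statuses in the intersection graph *)

Section IntersectionGraphStatus.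
Variables p t : nat.
Hypothesis t_gt1 : (1 < t)%N.
Implicit Types A B : Gamma p t.

Lemma card_Gamma : #|Gamma p t| = 'C(p, t).
Proof.
rewrite card_sig -[in RHS](card_ord p) -card_draws.
by apply: eq_card => A; rewrite !inE.
Qed.

(** Disjointness already forces [A != B], because [t]-subsets are non-empty. *)
Lemma coadj_GammaE A B : coadj A B = (val A :&: val B == set0).
Proof.
rewrite /coadj /= /meets; case: eqVneq => [->|] /=; last by rewrite negbK.
by rewrite setIid -cards_eq0 (eqP (valP B)) eqn0Ngt ltnW.
Qed.

(** The non-neighbours of [A] are the [t]-subsets of its complement. *)
Lemma card_coadj_Gamma A : #|coadj A| = 'C(p - t, t).
Proof.
have <- : #|~: val A| = (p - t)%N by rewrite cardsCs setCK card_ord (eqP (valP A)).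
rewrite -cards_draws -(card_imset _ val_inj).
apply: eq_card => X; rewrite !inE; apply/imsetP/andP => [[B AB ->]|[XA cX]].
  split; last exact: (valP B).
  by rewrite subsets_disjoint setCK disjoint_sym -setI_eq0 -coadj_GammaE.
exists (exist _ X cX : tsubset p t) => //; rewrite -topredE /= coadj_GammaE /=.
by rewrite setI_eq0 disjoint_sym disjoints_subset.
Qed.

Lemma Gamma_diameter2 A B : coadj A B -> exists2 C : Gamma p t, adj A C & adj C B.
Proof.
rewrite coadj_GammaE => /eqP AB0.
have cA := eqP (valP A).
have [x xA] : exists x, x \in val A by apply/card_gt0P; rewrite cA ltnW.
have [b bB] : exists b, b \in val B.
  by apply/card_gt0P; rewrite (eqP (valP B)) ltnW.
have cAx : #|val A :\ x| = t.-1 by move: cA; rewrite (cardsD1 x) xA => /(congr1 predn).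
(* Here [1 < t] is essential: after [x] is exchanged for [b], the point [y] of [A] remains. *)
have [y yAx] : exists y, y \in val A :\ x.
  by apply/card_gt0P; rewrite cAx -subn1 subn_gt0.
have yA : y \in val A by case/setD1P: yAx.
have disj z : z \in val A -> z \in val B -> false.
  by move=> zA zB; rewrite -(in_set0 z) -AB0 inE zA zB.
have cC : #|b |: val A :\ x| == t.
  have bnA : b \notin val A by apply/negP => /disj/(_ bB).
  rewrite cardsU1 cAx in_setD1 (negPf bnA) andbF add1n; apply/eqP.
  exact/prednK/ltnW.
pose C : tsubset p t := exist _ (b |: val A :\ x) cC.
exists C; rewrite /= /meets; apply/andP; split.
(* As [A] and [B] are disjoint, [b] distinguishes [C] from [A] and [y] distinguishes it from [B];
   conversely [y] lies in both [C] and [A], and [b] in both [C] and [B]. *)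
- apply/eqP => /(congr1 val)/= /setP/(_ b).
  by rewrite !inE eqxx /= => /disj/(_ bB).
- by apply/set0Pn; exists y; rewrite inE yA setU1r.
- apply/eqP => /(congr1 val)/= /setP/(_ y).
  by rewrite setU1r // => /esym/(disj y yA).
by apply/set0Pn; exists b; rewrite inE bB setU11.
Qed.

Lemma card_adj_Gamma A : (#|@adj (Gamma p t) A| + 'C(p - t, t)).+1 = 'C(p, t).
Proof. by rewrite -(card_coadj_Gamma A) card_adj_coadj card_Gamma. Qed.

(** With N vertices and K non-neighbours, the sum of distances is (N - K - 1) + 2K. *)
Lemma status_Gamma A : status A = ('C(p, t) + 'C(p - t, t)).-1.
Proof.
rewrite status_diameter2 ?card_coadj_Gamma; last exact: Gamma_diameter2.
by rewrite -(card_adj_Gamma A) addSn /= -addnn addnA.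
Qed.

Lemma double_card_edges_Gamma :
  (#|edges (Gamma p t)|.*2 = 'C(p, t) * ('C(p, t) - 'C(p - t, t)).-1)%N.
Proof.
rewrite (double_card_rel_pairs (@adj_sym _) (@adj_irr (Gamma p t))).
rewrite -card_Gamma -sum_nat_const; apply: eq_bigr => A _.
by rewrite card_Gamma -(card_adj_Gamma A) -addSn addnK.
Qed.

Lemma double_card_nonedges_Gamma :
  (#|nonedges (Gamma p t)|.*2 = 'C(p, t) * 'C(p - t, t))%N.
Proof.
rewrite (double_card_rel_pairs (@coadj_sym _) (@coadj_irr (Gamma p t))).
rewrite -card_Gamma -sum_nat_const.
by apply: eq_bigr => A _; rewrite card_coadj_Gamma.
Qed.

End IntersectionGraphStatus.

(** * Passage to rational numbers and the final formulas *)

Lemma half_natr (m n : nat) : m.*2 = n -> m%:R = 2^-1 * n%:R :> rat.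
Proof. by move=> <-; rewrite -mul2n natrM mulKf. Qed.

Lemma natr_bin2 (n : nat) : 'C(n, 2)%:R = 2^-1 * (n%:R * (n%:R - 1)) :> rat.
Proof.
(* At 0 the predecessor in [nat] differs from n - 1 in [rat], but the factor n vanishes. *)
case: n => [|n]; first by rewrite !mul0r mulr0.
rewrite -[in X in _ * X]natr1 addrK natr1 -natrM.
by apply: half_natr; rewrite bin2 even_halfK // oddM /= andNb.
Qed.

Theorem theorem3p6 (p t : nat) (ht : (1 < t < p)%N) :
  let N : rat := 'C(p, t)%:R in
  let K : rat := 'C(p - t, t)%:R in
  let P : rat := 'C('C(p, t), 2)%:R in
  ((2 * t <= p)%N ->
    [/\ (S1 (Gamma p t))%:R = N * (N - K - 1) * (N + K - 1),
        (S2 (Gamma p t))%:R =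
          2^-1 * N * (N - K - 1) * (N + K - 1) ^+ 2,
        (coS1 (Gamma p t))%:R = K * N * (N + K - 1)
      & (coS2 (Gamma p t))%:R =
          (P - 2^-1 * N * (N - K - 1)) * (N + K - 1) ^+ 2]) /\
  ((p < 2 * t)%N ->
    [/\ (S1 (Gamma p t))%:R = N * (N - 1) ^+ 2,
        (S2 (Gamma p t))%:R = 2^-1 * N * (N - 1) ^+ 3,
        (coS1 (Gamma p t))%:R = 2 * P * (N - 1) - N * (N - 1) ^+ 2
      & (coS2 (Gamma p t))%:R =
          (P - 2^-1 * N * (N - 1)) * (N - 1) ^+ 2]).
Proof.
move=> N K P; have /andP[t_gt1 t_lt_p] := ht.
(* A vertex exists since [t < p], and its degree count [KN] gives K + 1 <= N, so the truncated
   subtractions in [nat] become genuine differences in [rat]. *)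
have N_gt0 : (0 < #|Gamma p t|)%N by rewrite card_Gamma bin_gt0 ltnW.
have /card_gt0P[A _] := N_gt0.
have KN := card_adj_Gamma t_gt1 A.
have sE : ('C(p, t) + 'C(p - t, t)).-1%:R = N + K - 1 :> rat.
  by rewrite -natrD -subn1 natrB // -KN.
have EE : #|edges (Gamma p t)|%:R = 2^-1 * (N * (N - K - 1)) :> rat.
  rewrite (half_natr (double_card_edges_Gamma p t_gt1)) natrM -subn1.
  by rewrite natrB ?natrB // -KN; lia.
have EN : #|nonedges (Gamma p t)|%:R = 2^-1 * (N * K) :> rat.
  by rewrite (half_natr (double_card_nonedges_Gamma p t_gt1)) natrM.
have PE : P = 2^-1 * (N * (N - 1)) by exact: natr_bin2.
have stE := @status_Gamma p t t_gt1.
rewrite (S1_const_status stE) (S2_const_status stE).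
rewrite (coS1_const_status stE) (coS2_const_status stE).
have K0 : (p < 2 * t)%N -> K = 0 by move=> lt_p; rewrite /K bin_small //; lia.
clearbody N K P; move: EE EN sE.
(* Otherwise rewriting with natrM tries to unfold these cardinals. *)
generalize #|edges (Gamma p t)| #|nonedges (Gamma p t)|.
generalize ('C(p, t) + 'C(p - t, t)).-1 => s m n EE EN sE.
rewrite !natrM sE EE EN PE.
(* The second case is the first at K = 0; its formula for [coS1] is zero on both sides, as 2P = N(N
   - 1). *)
split=> [_|/K0->]; first by split; field.
by split; field.
Qed.
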